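(* Let $K$ be a metric space, $\lambda>0$, and $f:K\to\mathbb{C}$ a bounded function. (a) If for all $x\in K$ there is an open neighborhood $U_x$ of $x$ with $\|f|U_x\|_{D(U_x)}\le\lambda$, then $f\in D(K)$ and $\|f\|_{D(K)}\le\lambda$. (b) If for all $x\in K$ there is an open neighborhood $U_x$ of $x$ with $\|f|U_x\|_{qD(U_x)}\le\lambda$, then $\|f\|_{qD(K)}\le\lambda$.
   Context: For a metric space $X$, $D(X)$ is the set of all $f:X\to\mathbb{C}$ of the form $f=(\varphi_1-\varphi_2)+i(\varphi_3-\varphi_4)$ with $\varphi_1,\dots,\varphi_4$ bounded real-valued lower semi-continuous functions on $X$. Equivalently, $f\in D(X)$ iff there is a sequence $(\varphi_j)$ of continuous complex-valued functions on $X$ with $\sup_{x\in X}\sum_j|\varphi_j(x)|<\infty$ and $f=\sum_j\varphi_j$ pointwise; $\|f\|_{D(X)}$ is the infimum of $\sup_{x\in X}\sum_j|\varphi_j(x)|$ over all such sequences, and $\|f\|_{D(X)}=\infty$ if $f\notin D(X)$. $C_b(X)$ is the space of bounded continuous complex-valued functions on $X$, and $\|f\|_{qD(X)}=\inf_{\varphi\in C_b(X)}\|f-\varphi\|_{D(X)}$ (equal to $\infty$ if $f\notin D(X)$). *)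

(* Defs.v *)
From HB Require Import structures.
From mathcomp Require Import all_boot all_order all_algebra.
From mathcomp Require Import all_classical all_reals all_analysis.
From mathcomp Require Import complex.
Import numFieldNormedType.Exports.

Set Implicit Arguments.
Unset Strict Implicit.
Unset Printing Implicit Defensive.

Import Order.TTheory GRing.Theory Num.Theory.

Local Open Scope classical_set_scope.
Local Open Scope ring_scope.
Local Open Scope complex_scope.

(* Complex-valued functions take values in R[i]^o, the complex numbers with
   their usual topology. Everything below depends on a metric space only
   through its topology; a subset U of a metric space K, coerced to a type,
   carries the topology of the induced metric. *)

Section Dspace.
Context {R : realType} {X : topologicalType}.
Implicit Types (f phi : X -> R[i]^o) (phis : nat -> X -> R[i]^o).

Definition bounded_lsc (g : X -> R) : Prop :=
  bounded_fun g /\ lower_semicontinuous (EFin \o g).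

Definition Dspace : set (X -> R[i]^o) :=
  [set f | exists g1 g2 g3 g4 : X -> R,
    [/\ bounded_lsc g1, bounded_lsc g2, bounded_lsc g3 & bounded_lsc g4] /\
    forall x, f x = (g1 x - g2 x) +i* (g3 x - g4 x)].

(* sup_x sum_j |phi_j(x)|, taken in [0, +oo]: the added 0 only makes the
   value 0 (and not -oo) when X is empty. *)
Definition sup_abs_sum phis : \bar R :=
  ereal_sup (0%E |` range (fun x =>
    \sum_(0 <= j <oo) (ComplexField.Normc.normc (phis j x))%:E)%E).

Definition D_representation f phis : Prop :=
  [/\ forall j, continuous (phis j),
      (sup_abs_sum phis < +oo)%E &
      forall x, series (fun j => phis j x) @ \oo --> f x].

Definition Dnorm f : \bar R :=
  if `[< Dspace f >] then ereal_inf (sup_abs_sum @` D_representation f)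
  else +oo%E.

Definition Cb : set (X -> R[i]^o) :=
  [set phi | continuous phi /\ bounded_fun phi].

(* Since Cb is contained in the vector space Dspace, f - phi lies in Dspace
   for some phi in Cb only if f does; hence qDnorm f = +oo off Dspace. *)
Definition qDnorm f : \bar R :=
  ereal_inf [set Dnorm (fun x => f x - phi x) | phi in Cb].

End Dspace.

(* Main.v *)
(* Extended by zero off an open V_n and multiplied by a weight vanishing off V_n, a
   bounded continuous function on V_n becomes continuous on K; so for a
   locally finite partition of unity (w_n) subordinate to the V_n, local series
   f - psi_n = sum_j phi_(n,j) glue to psi = sum_n w_n psi_n and
   phi_j = sum_n w_n phi_(n,j), with sum_j |phi_j| <= c if each local series
   satisfies that bound. Part (a) is the case psi_n = 0. In (b), boundedness of
   psi comes from |psi_n| <= |f| + |f - psi_n| <= sup |f| + c. A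
   sigma-disjoint open refinement (half of A. H. Stone's theorem) replaces an
   arbitrary open cover by a countable one, because local representations on
   disjoint open sets combine into one on their union. *)
Require Import Defs.
From HB Require Import structures.
From mathcomp Require Import all_boot all_order all_algebra.
From mathcomp Require Import all_classical all_reals all_analysis.
From mathcomp Require Import complex.
From mathcomp Require wochoice.
Import numFieldNormedType.Exports.
Import Order.TTheory GRing.Theory Num.Theory.
Local Open Scope classical_set_scope.
Local Open Scope ring_scope.
Local Open Scope complex_scope.
Local Notation normc := ComplexField.Normc.normc.

(** * Sigma-disjoint open refinements of open covers *)

Section Refinement.
Context {R : realType} {K : metricType R}.
Implicit Types (U : K -> set K).

(* For a well-ordering of the indices, [W n x] below collects the points within
   1/(n+1) of some y whose 3/(n+1)-ball lies in U_x and which belongs to no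
   earlier U_z. If z is in both [W n x] and [W n x'], the witnesses y and y'
   are less than 3/(n+1) apart, so y is in U_x' and y' is in U_x, and neither
   of x, x' precedes the other. *)
Lemma sigma_disjoint_refinement U :
    (forall x, open (U x)) -> (forall x, U x x) ->
  exists V : nat -> K -> set K,
    [/\ forall n x, open (V n x), forall n x, V n x `<=` U x,
        forall n, trivIset setT (V n) & forall z, exists n x, V n x z].
Proof.
move=> Uo Ux; have [le le_wo] := wochoice.well_ordering_principle K.
pose first x y := [/\ U x y & forall z, U z y -> le x z].
pose r (n : nat) : R := n.+1%:R^-1.
have r0 n : 0 < r n by rewrite invr_gt0.
(* The well-ordering provides a unique least element in each nonempty subset; antisymmetry is this
   uniqueness applied to {x, y}. *)
have le_anti x y : le x y -> le y x -> x = y.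
  move=> lxy lyx.
  have [|z [_ z_uniq]] := le_wo [pred w | (w == x) || (w == y)].
    by exists x; rewrite !inE eqxx.
  have le_refl w : le w w.
    have [|v [[vw v_min] _]] := le_wo (pred1 w); first by exists w; rewrite inE.
    by move: vw (v_min w); rewrite !inE => /eqP -> /(_ (eqxx _)).
  by rewrite -(z_uniq x) ?(z_uniq y)//; split; rewrite ?inE ?eqxx ?orbT// => w;
    rewrite !inE => /orP[] /eqP ->.
pose W n x := [set z | exists y, [/\ first x y, mdist z y < r n &
  ball y (3 * r n) `<=` U x]].
exists W; split.
- move=> n x; rewrite openE => z [y [fxy zy yU]]; rewrite /interior/=.
  rewrite -nbhs_ballE; exists (r n - mdist z y); first by rewrite /= subr_gt0.
  move=> z'; rewrite ballEmdist/= => zz'; exists y; split => //.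
  rewrite (le_lt_trans (metric_triangle z' z y))// metric_sym.
  by rewrite -ltrBrDr.
- move=> n x z [y [_ zy]]; apply; rewrite ballEmdist/= metric_sym.
  by rewrite (lt_trans zy)// ltr_pMl// ltr1n.
- move=> n; apply/trivIsetP => x x' _ _ /eqP xx'; rewrite -subset0 => z.
  move=> [[y [[Uxy fy] zy yU]] [y' [[Uxy' fy'] zy' yU']]].
  have yy' : mdist y y' < 3 * r n.
    rewrite (le_lt_trans (metric_triangle y z y'))// (@lt_trans _ _ (r n + r n))//.
      by rewrite ltrD// metric_sym.
    by rewrite -mulr2n -[ltLHS]mulr_natl ltr_pM2r// ltr_nat.
  apply: xx'; apply: le_anti.
    by apply: fy; apply: yU'; rewrite ballEmdist/= metric_sym.
  by apply: fy'; apply: yU; rewrite ballEmdist.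
- move=> z; have [|x [[xz x_min] _]] := le_wo [pred x | `[< U x z >]].
    by exists z; rewrite inE; exact: Ux.
  have Uxz : U x z by move: xz; rewrite inE.
  have := Uo x; rewrite openE => /(_ _ Uxz); rewrite /interior/= -nbhs_ballE.
  move=> [e /= e0 eU].
  (* This [n] gives 3/(n+1) <= [e], and [z] is its own witness: it lies in no set of the cover
     earlier than [U x]. *)
  pose n := Num.truncn (3 / e); exists n, x, z; split.
  + by split=> // w Uwz; apply: x_min; rewrite inE.
  + by rewrite mdistxx.
  + apply: subset_trans eU; apply: le_ball.
    rewrite /r ler_pdivrMr// mulrC -ler_pdivrMr//.
    by rewrite ltW// truncnS_gt.
Qed.
End Refinement.

(** * Continuity of positive parts and of locally finite sums *)

Lemma max0r_continuous {R : realType} {T : topologicalType} (g : T -> R) :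
  continuous g -> continuous (fun x => Num.max 0 (g x)).
Proof.
move=> gc; have -> : (fun x => Num.max 0 (g x)) = (fun x => (g x + `|g x|) / 2).
  by apply/funext => x; rewrite maxr_absE add0r sub0r normrN.
move=> x; apply: cvgMl; apply: cvgD; first exact: gc.
by apply: cvg_norm; exact: gc.
Qed.

Section LocallyFinite.
Context {T : topologicalType} {C : numFieldType} {W : normedModType C}.

(** The bound [N z] may jump with [z], but near [x] all terms from [N x] on vanish, so truncating at
    [N z] or at [N x] gives the same value. With the bound frozen at [N x], the sum is a finite sum
    of continuous functions. *)
Lemma locally_finite_sum_continuous (F : nat -> T -> W) (N : T -> nat) :
    (forall n, continuous (F n)) ->
    (forall x, \forall z \near x, forall n, (N x <= n)%N -> F n z = 0) ->
  continuous (fun x => \sum_(n < N x) F n x).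
Proof.
move=> Fc Fl x.
have Fsum z m : (forall n, (m <= n)%N -> F n z = 0) ->
    \sum_(n < N z) F n z = \sum_(n < m) F n z.
  have sum_max (a b : nat) : (forall n, (a <= n)%N -> F n z = 0) ->
      \sum_(n < a) F n z = \sum_(n < maxn a b) F n z.
    move=> Fa; rewrite -!(big_mkord predT (fun n => F n z)).
    rewrite (big_cat_nat _ (leq_maxl a b))//=.
    rewrite [X in _ + X]big1_seq ?addr0// => n.
    by rewrite mem_index_iota => /andP[_ /andP[/Fa]].
  move=> Fm; rewrite (sum_max _ m); last exact: (nbhs_singleton (Fl z)).
  by rewrite maxnC -sum_max.
apply: (@cvg_trans _ ((fun z => \sum_(n < N x) F n z) @ x)).
  by apply: near_eq_cvg; near=> z; apply/esym/Fsum; near: z; exact: Fl.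
rewrite /continuous_at; apply: cvg_big => [|n _]; first exact: add_continuous.
exact: Fc.
Unshelve. all: by end_near. Qed.

End LocallyFinite.

(** * Partitions of unity for countable open covers *)

Section Partition.
Context {R : realType} {K : metricType R}.
Implicit Types (V : set K) (x y : K) (r : R).

(* min (1, d(x, ~ V)); including 1 in the set keeps it nonempty when V is
   the whole space. *)
Definition depth (V : set K) (x : K) : R :=
  inf (1 |` [set mdist x y | y in ~` V]).

Lemma depth_lb V x : lbound (1 |` [set mdist x y | y in ~` V]) 0.
Proof. by move=> _ [->|[y _ <-]] //=; exact: mdist_ge0. Qed.

Lemma depth_le V x r : (1 |` [set mdist x y | y in ~` V]) r -> depth V x <= r.
Proof. by move=> Sr; apply: ge_inf => //; exists 0; exact: depth_lb. Qed.

Lemma le_depth V x r :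
  lbound (1 |` [set mdist x y | y in ~` V]) r -> r <= depth V x.
Proof. by apply: lb_le_inf; exists 1; left. Qed.

Lemma depth_ge0 V x : 0 <= depth V x.
Proof. exact/le_depth/depth_lb. Qed.

Lemma depth_le1 V x : depth V x <= 1.
Proof. by apply: depth_le; left. Qed.

Lemma depth_gt0 V x : open V -> V x -> 0 < depth V x.
Proof.
rewrite openE => /[apply]; rewrite /interior/= -nbhs_ballE => -[e /= e0 eV].
apply: (@lt_le_trans _ _ (Num.min 1 e)); first by rewrite lt_min ltr01.
apply: le_depth => _ [->|[y Vy <-]]; rewrite ge_min ?lexx//.
apply/orP; right; rewrite leNgt; apply/negP => xy.
by apply/Vy/eV; rewrite ballEmdist.
Qed.

Lemma depth_eq0 V x : ~ V x -> depth V x = 0.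
Proof.
move=> Vx; apply/le_anti; rewrite depth_ge0 andbT; apply: depth_le.
by right; exists x => //; rewrite mdistxx.
Qed.

Lemma depth_lip V x y : depth V x <= depth V y + mdist x y.
Proof.
rewrite -lerBlDr; apply: le_depth => _ [->|[z Vz <-]]; rewrite lerBlDr.
  by rewrite (le_trans (depth_le1 V x))// lerDl mdist_ge0.
rewrite addrC (le_trans _ (metric_triangle x y z))//.
by apply: depth_le; right; exists z.
Qed.

Lemma depth_continuous V : continuous (depth V).
Proof.
move=> x; apply/cvgrPdist_lt => e e0; apply/nbhs_ballP.
exists e => //= y; rewrite ballEmdist/= => xy.
rewrite (le_lt_trans _ xy)// ler_norml lerNl opprB !lerBlDl.
by rewrite depth_lip metric_sym depth_lip.
Qed.

(** Subtracting [n] times the sum of the earlier depths makes the family locally finite: once some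
    [h k] is bounded below near [x], the subtracted quantity exceeds 1 >= [h n] for large [n]. The
    weights are the resulting [t n] divided by their sum. *)
Lemma countable_partition_of_unity (V : nat -> set K) :
    (forall n, open (V n)) -> (forall x, exists n, V n x) ->
  exists (w : nat -> K -> R) (N : K -> nat),
    [/\ forall n, continuous (w n), forall n x, 0 <= w n x,
        forall n x, ~ V n x -> w n x = 0,
        forall x, \forall z \near x, forall n, (N x <= n)%N -> w n z = 0 &
        forall x, \sum_(n < N x) w n x = 1].
Proof.
move=> Vo Vcover.
pose h n := depth (V n).
pose t n x := Num.max 0 (h n x - n%:R * \sum_(k < n) h k x).
have h0 n x : 0 <= h n x by exact: depth_ge0.
have t0 n x : 0 <= t n x by rewrite /t le_max lexx.
have tV n x : ~ V n x -> t n x = 0.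
  move=> Vx; rewrite /t /h depth_eq0//; apply/max_idPl.
  by rewrite sub0r oppr_le0 mulr_ge0// sumr_ge0// => k _; exact: h0.
have tc n : continuous (t n).
  apply: max0r_continuous => x.
  apply: cvgB; first exact: depth_continuous.
  apply: cvgM; first exact: cvg_cst.
  apply: cvg_big => [|k _]; first exact: add_continuous.
  exact: depth_continuous.
have tl x : exists N, \forall z \near x, forall n, (N <= n)%N -> t n z = 0.
  have [k Vk] := Vcover x; have hk : 0 < h k x by exact: depth_gt0.
  pose d := h k x / 2; have d0 : 0 < d by rewrite divr_gt0.
  (* The first bound puts [h k] among the subtracted terms; the second ensures [n * d >= 1]. *)
  exists (maxn k.+1 (Num.truncn d^-1).+1); near=> z => n.
  rewrite geq_max => /andP[kn nd]; apply/max_idPl; rewrite subr_le0.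
  apply: (le_trans (depth_le1 _ _)).
  have dz : d <= h k z.
    near: z; apply: (cvgr_ge (h k x)); first exact: depth_continuous.
    by rewrite ltr_pdivrMr// ltr_pMr// ltr1n.
  apply: (@le_trans _ _ (n%:R * d)).
    rewrite -ler_pdivrMr// mul1r ltW// (lt_le_trans (truncnS_gt _))//.
    by rewrite ler_nat.
  rewrite ler_wpM2l// (le_trans dz)// (bigD1 (Ordinal kn))//= lerDl.
  exact: sumr_ge0.
have [N Nt] := choice tl.
have Npos x : 0 < \sum_(n < N x) t n x.
  have ex_h : exists n, 0 < h n x.
    by have [k Vk] := Vcover x; exists k; exact: depth_gt0.
  (* At the least index with positive depth all earlier depths are 0, so nothing is subtracted and
     [t m x = h m x]. *)
  pose m := ex_minn ex_h.
  have [hm m_min] : 0 < h m x /\ forall n, 0 < h n x -> (m <= n)%N.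
    by rewrite /m; case: ex_minnP.
  have tm : 0 < t m x.
    rewrite /t big1 ?mulr0 ?subr0 ?lt_max ?hm ?orbT// => k _.
    apply/eqP; rewrite eq_le h0 andbT leNgt; apply/negP => /m_min.
    by rewrite leqNgt ltn_ord.
  have mN : (m < N x)%N.
    rewrite ltnNge; apply/negP => Nm; move: tm.
    by rewrite (nbhs_singleton (Nt x))// ltxx.
  by rewrite (bigD1 (Ordinal mN))//= ltr_pwDl// sumr_ge0.
pose S x := \sum_(n < N x) t n x.
have Sc : continuous S by exact: locally_finite_sum_continuous.
exists (fun n x => t n x / S x), N; split.
- move=> n x; apply: cvgM; first exact: tc.
  by apply: cvgV; [rewrite gt_eqF//; exact: Npos|exact: Sc].
- by move=> n x; rewrite divr_ge0// ltW//; exact: Npos.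
- by move=> n x /tV ->; rewrite mul0r.
- move=> x; apply: filterS (Nt x) => z tz n /tz ->; exact: mul0r.
- by move=> x; rewrite -mulr_suml divff// gt_eqF//; exact: Npos.
Unshelve. all: by end_near. Qed.

End Partition.

(** * Complex limits and bounds through the real-valued modulus *)

Section ComplexTopology.
Context {R : realType}.
Implicit Types (z : R[i]^o).

Lemma norm_normcE z : `|z| = (normc z)%:C.
Proof. by case: z. Qed.

Lemma normc_ge0 z : 0 <= normc z.
Proof. by rewrite -lecR -norm_normcE normr_ge0. Qed.

Lemma normcD_le z1 z2 : normc (z1 + z2) <= normc z1 + normc z2.
Proof. by rewrite -lecR rmorphD /= -!norm_normcE ler_normD. Qed.

Lemma normc_sum_le (I : Type) (r : seq I) (P : pred I) (F : I -> R[i]^o) :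
  normc (\sum_(i <- r | P i) F i) <= \sum_(i <- r | P i) normc (F i).
Proof.
apply: (big_ind2 (fun z a => normc z <= a)) => // [|z a y b za yb].
  by rewrite ComplexField.Normc.normc0.
by rewrite (le_trans (normcD_le _ _))// lerD.
Qed.

Lemma normcN z : normc (- z) = normc z.
Proof. by case: z => a b /=; rewrite !sqrrN. Qed.

Lemma normc_real (a : R) : normc a%:C = `|a|.
Proof. by rewrite /= expr0n addr0 sqrtr_sqr. Qed.

Lemma normc_Re_le z : `|complex.Re z| <= normc z.
Proof. by rewrite -lecR -norm_normcE normc_ge_Re. Qed.

Lemma normc_Im_le z : `|complex.Im z| <= normc z.
Proof.
case: z => a b /=; rewrite -[X in X <= _]sqrtr_sqr ler_sqrt ?addr_ge0 ?sqr_ge0//.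
by rewrite lerDr sqr_ge0.
Qed.

(** The norm of [R[i]] is itself complex-valued; a positive element of [R[i]] is real, so real
    tolerances suffice. *)
Lemma cvg_normcP {T : Type} {F : set_system T} {FF : Filter F}
    (g : T -> R[i]^o) z :
  g @ F --> z <-> forall e : R, 0 < e -> \forall t \near F, normc (z - g t) < e.
Proof.
split=> [/cvgrPdist_lt gz e e0|gz].
  have /gz : 0 < e%:C :> R[i] by rewrite ltcR.
  by apply: filterS => t; rewrite norm_normcE ltcR.
apply/cvgrPdist_lt => e e0.
have er : e = (complex.Re e)%:C by rewrite RRe_real// gtr0_real.
have /gz : 0 < complex.Re e by rewrite -ltcR -er.
by apply: filterS => t; rewrite [in X in _ -> X]er norm_normcE ltcR.
Qed.

Section cvg.
Context {T : Type} {F : set_system T} {FF : Filter F}.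

Lemma cvg_Re (g : T -> R[i]^o) z :
  g @ F --> z -> complex.Re (g t) @[t --> F] --> complex.Re z.
Proof.
move=> /cvg_normcP gz; apply/cvgrPdist_lt => e /gz; apply: filterS => t.
by apply: le_lt_trans; rewrite -raddfB normc_Re_le.
Qed.

Lemma cvg_Im (g : T -> R[i]^o) z :
  g @ F --> z -> complex.Im (g t) @[t --> F] --> complex.Im z.
Proof.
move=> /cvg_normcP gz; apply/cvgrPdist_lt => e /gz; apply: filterS => t.
by apply: le_lt_trans; rewrite -raddfB normc_Im_le.
Qed.

Lemma cvg_real_complex (g : T -> R) (a : R) :
  g @ F --> a -> (g t)%:C @[t --> F] --> (a%:C : R[i]^o).
Proof.
move=> /cvgrPdist_lt ga; apply/cvg_normcP => e /ga; apply: filterS => t.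
by rewrite -rmorphB normc_real.
Qed.

Lemma cvg_normc_le (g : T -> R[i]^o) z (c : R) : ProperFilter F ->
  g @ F --> z -> (forall t, normc (g t) <= c) -> normc z <= c.
Proof.
move=> PF /cvg_normcP gz gc; apply/ler_addgt0Pr => e /gz ge.
have [t te] := filter_ex ge.
by rewrite -(subrK (g t) z) (le_trans (normcD_le _ _))// addrC lerD// ltW.
Qed.

End cvg.

Lemma bounded_fun_normcP {T : Type} (g : T -> R[i]^o) :
  bounded_fun g <-> exists M : R, forall t, normc (g t) <= M.
Proof.
split=> [[M [Mr gM]]|[M gM]].
  exists (complex.Re (M + 1)) => t.
  rewrite -lecR -norm_normcE RRe_real; last by rewrite realD.
  by apply: gM => //; rewrite ltrDl.
exists M%:C; split=> [|e Me t _]; first by rewrite complex_real.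
by rewrite /= (le_trans _ (ltW Me))// norm_normcE lecR.
Qed.

End ComplexTopology.

(** * Weighted extension by zero *)

Section Weighted.
Context {R : realType} {T : topologicalType}.

(** At a point outside [V] the product is dominated by a constant multiple of [w], which tends to 0
    there. *)
Lemma weighted_continuous (V : set T) (w : T -> R) (g : T -> R[i]^o) (c : R) :
    open V -> continuous w -> (forall x, 0 <= w x) ->
    (forall x, ~ V x -> w x = 0) ->
    (forall x, V x -> {for x, continuous g}) ->
    (forall x, V x -> normc (g x) <= c) ->
  continuous (fun x => (w x)%:C * g x : R[i]^o).
Proof.
move=> Vo wc w0 wV gc gb x; have [Vx|nVx] := pselect (V x).
  by apply: cvgM; [apply: cvg_real_complex; exact: wc|exact: gc].
rewrite /continuous_at wV// mul0r; apply/cvg_normcP => e e0.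
(* The constant [|c| + 1] is positive whatever the sign of [c], so the tolerance can be divided by
   it. *)
have wb y : normc ((w y)%:C * g y) <= w y * (`|c| + 1).
  have [Vy|/wV ->] := pselect (V y); last first.
    by rewrite !mul0r ComplexField.Normc.normc0.
  rewrite ComplexField.Normc.normcM normc_real ger0_norm// ler_wpM2l//.
  by rewrite (le_trans (gb _ Vy))// ler_wpDr// ler_norm.
have c1 : 0 < `|c| + 1 by rewrite ltr_wpDl.
near=> y; rewrite sub0r normcN (le_lt_trans (wb y))// -ltr_pdivlMr//.
near: y; apply: (cvgr_lt (w x)); first exact: wc.
by rewrite wV// divr_gt0.
Unshelve. all: by end_near. Qed.

End Weighted.

(** * Absolutely bounded series, the space [Dspace] and [Dnorm] *)

Section Representation.
Context {R : realType} {X : topologicalType}.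
Implicit Types (f : X -> R[i]^o) (phis : nat -> X -> R[i]^o) (c : R).

(** The sum is the supremum of its continuous partial sums: a strict lower bound at [x] already
    holds for some partial sum, hence for that partial sum near [x], hence for the limit. *)
Lemma series_bounded_lsc (u : nat -> X -> R) c :
    (forall j, continuous (u j)) -> (forall j x, 0 <= u j x) ->
    (forall n x, series (u^~ x) n <= c) ->
  [/\ forall x, cvgn (series (u^~ x)) &
      bounded_lsc (fun x => limn (series (u^~ x)))].
Proof.
move=> uc u0 uc_le.
have u_nd x : nondecreasing_seq (series (u^~ x)).
  by apply/nondecreasing_series => j _ _; exact: u0.
have u_cvg x : cvgn (series (u^~ x)).
  by apply: nondecreasing_is_cvgn => //; exists c => _ [n _ <-].
have le_lim n x : series (u^~ x) n <= limn (series (u^~ x)).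
  exact: nondecreasing_cvgn_le.
split => //; split; last first.
  move=> x a; rewrite lte_fin => /= alim.
  have [n an] : exists n, a < series (u^~ x) n.
    exact: filter_ex (cvgr_gt _ (u_cvg x) _ alim).
  exists [set y | a < series (u^~ y) n].
    apply: (cvgr_gt (series (u^~ x) n)) => //.
    by apply: cvg_big => [|j _]; [exact: add_continuous|exact: uc].
  by move=> y /= ay; rewrite lte_fin (lt_le_trans ay).
exists c; split => [|M cM x _ /=]; first exact: num_real.
rewrite ger0_norm; last first.
  by apply: le_trans (le_lim 0%N x); rewrite seriesEnat /= big_nil.
by rewrite (le_trans _ (ltW cM))//; apply: limr_le => //; exact: nearW.
Qed.

(** Real and imaginary parts of the terms are split into positive and negative parts; each of the
    four resulting series has nonnegative continuous terms and partial sums at most [c]. *)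
Lemma bounded_series_Dspace f phis c :
    (forall j, continuous (phis j)) ->
    (forall x n, series (fun j => normc (phis j x)) n <= c) ->
    (forall x, series (phis^~ x) @ \oo --> f x) ->
  Dspace f.
Proof.
move=> phic phi_le phif.
have part (p : R[i]^o -> R) :
    (forall (T : Type) (F : set_system T) (FF : Filter F) (g : T -> R[i]^o) z,
      g @ F --> z -> p (g t) @[t --> F] --> p z) ->
    (forall z, `|p z| <= normc z) ->
    (forall x n, p (series (phis^~ x) n) = series (fun j => p (phis j x)) n) ->
  exists g1 g2 : X -> R, [/\ bounded_lsc g1, bounded_lsc g2 &
    forall x, p (f x) = g1 x - g2 x].
  move=> pc p_le p_series.
  (* The sign [s = 1] yields the positive parts and [s = -1] the negative parts. *)
  have sgn (s : R) : `|s| = 1 ->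
      [/\ forall x, cvgn (series (fun j => Num.max 0 (s * p (phis j x)))) &
      bounded_lsc (fun x => limn (series (fun j => Num.max 0 (s * p (phis j x)))))].
    move=> s1; apply: (@series_bounded_lsc
        (fun j x => Num.max 0 (s * p (phis j x))) c) => [j|j x|n x].
    - apply: max0r_continuous => x; apply: cvgM; first exact: cvg_cst.
      by apply: pc; exact: phic.
    - by rewrite le_max lexx.
    - apply: le_trans (phi_le x n); rewrite !seriesEnat; apply: ler_sum => j _.
      rewrite ge_max normc_ge0 (le_trans (ler_norm _))// normrM s1 mul1r.
      exact: p_le.
  have [cvg1 lsc1] := sgn 1 (normr1 _).
  have [|cvg2 lsc2] := sgn (-1); first by rewrite normrN1.
  exists (fun x => limn (series (fun j => Num.max 0 (1 * p (phis j x))))),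
    (fun x => limn (series (fun j => Num.max 0 (-1 * p (phis j x))))).
  split => // x; rewrite -limB//; apply: esym; apply: cvg_lim => //.
  rewrite (_ : _ - _ = fun n => p (series (phis^~ x) n)).
    by apply: pc; exact: phif.
  apply/funext => n; rewrite p_series -[LHS]/(series _ n - series _ n).
  rewrite !seriesEnat /= -sumrB.
  apply: eq_bigr => j _; rewrite mul1r mulN1r.
  case: (lerP 0 (p (phis j x))) => pj.
    by rewrite max_l ?subr0// oppr_le0.
  by rewrite max_r ?sub0r ?opprK// oppr_ge0 ltW.
have [| |x n|g1 [g2 [l1 l2 f12]]] := part (fun z => complex.Re z).
- by move=> T F FF g z; exact: cvg_Re.
- exact: normc_Re_le.
- by rewrite !seriesEnat raddf_sum.
have [| |x n|g3 [g4 [l3 l4 f34]]] := part (fun z => complex.Im z).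
- by move=> T F FF g z; exact: cvg_Im.
- exact: normc_Im_le.
- by rewrite !seriesEnat raddf_sum.
exists g1, g2, g3, g4; split => // x.
by rewrite -f12 -f34; case: (f x).
Qed.

(** A series of nonnegative terms is at most [c] exactly when its partial sums are; [0 <= c]
    accounts for the 0 adjoined in [sup_abs_sum]. *)
Lemma sup_abs_sum_leP phis c : 0 <= c ->
  (sup_abs_sum phis <= c%:E)%E <->
  forall x n, series (fun j => normc (phis j x)) n <= c.
Proof.
move=> c0; split=> [sup_le x n|phi_le].
  rewrite -lee_fin (le_trans _ sup_le)//.
  apply: (@le_trans _ _ (\sum_(0 <= j <oo) (normc (phis j x))%:E)%E).
    rewrite seriesEnat -sumEFin; apply: nneseries_lim_ge => j _ _.
    by rewrite lee_fin normc_ge0.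
  by apply: ereal_sup_ubound; right; exists x.
apply: ge_ereal_sup => _ [->|[x _ <-]]; first by rewrite lee_fin.
apply: lime_le.
  by apply: is_cvg_nneseries => j _ _; rewrite lee_fin normc_ge0.
by apply: nearW => n; rewrite sumEFin lee_fin; exact: phi_le.
Qed.

Lemma bounded_series_Dnorm f phis c : 0 <= c ->
    (forall j, continuous (phis j)) ->
    (forall x n, series (fun j => normc (phis j x)) n <= c) ->
    (forall x, series (phis^~ x) @ \oo --> f x) ->
  (Dnorm f <= c%:E)%E.
Proof.
move=> c0 phic phi_le phif; rewrite /Dnorm asboolT; last first.
  exact: bounded_series_Dspace phif.
have sup_le : (sup_abs_sum phis <= c%:E)%E by exact/sup_abs_sum_leP.
apply: le_trans sup_le; apply: ereal_inf_lbound; exists phis => //.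
split=> //; apply: (le_lt_trans (y := c%:E)); last exact: ltry.
exact/sup_abs_sum_leP.
Qed.

(** The infimum need not be attained; the strict inequality is what produces an actual series. *)
Lemma Dnorm_lt f c : 0 <= c -> (Dnorm f < c%:E)%E ->
  exists phis, [/\ forall j, continuous (phis j),
    forall x n, series (fun j => normc (phis j x)) n <= c &
    forall x, series (phis^~ x) @ \oo --> f x].
Proof.
move=> c0; rewrite /Dnorm; case: ifPn => [_|_]; last by rewrite ltNge leey.
move=> /ereal_inf_lt[_ [phis [phic _ phif] <-]] /ltW /sup_abs_sum_leP phi_le.
by exists phis; split => //; exact: phi_le.
Qed.

End Representation.

(** * Gluing local representations *)

Lemma near_eq_continuous {X Y : topologicalType} (x : X) (g h : X -> Y) :
  (\forall y \near x, g y = h y) -> {for x, continuous h} ->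
  {for x, continuous g}.
Proof.
move=> gh hc; rewrite /prop_for /continuous_at (nbhs_singleton gh).
by apply: cvg_trans hc; apply: near_eq_cvg; apply: filterS gh => y ->.
Qed.

(** All functions are total on [X] and constrained only at points of [U], so data on different sets
    can be combined without subtypes and restrict to subsets at once. *)
Definition local_rep {R : realType} {X : topologicalType} (f : X -> R[i]^o)
    (b c : R) (U : set X) (psi : X -> R[i]^o) (phis : nat -> X -> R[i]^o) :=
  forall x, U x ->
  [/\ {for x, continuous psi}, forall j, {for x, continuous (phis j)},
      normc (psi x) <= b,
      forall n, series (fun j => normc (phis j x)) n <= c &
      series (phis^~ x) @ \oo --> f x - psi x].

Section Gluing.
Context {R : realType} {K : metricType R}.
Variables (f : K -> R[i]^o) (b c : R).

Let representable U := exists psi phis, local_rep f b c U psi phis.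

(** By disjointness each point of the union determines its index, and since every [V i] is open this
    index is locally constant; the glued functions thus agree near each point with a single local
    family. *)
Lemma local_rep_bigcup (I : choiceType) (V : I -> set K) :
    (forall i, open (V i)) -> trivIset setT V ->
    (forall i, representable (V i)) ->
  representable (\bigcup_i V i).
Proof.
move=> Vo /trivIsetP Vdisj /choice[psi_ /choice[phis_ rep]].
have /choice[idx idxP] : forall x, exists o : option I,
    forall i, V i x -> o = Some i.
  move=> x; have [[i Vi]|noi] := pselect (exists i, V i x); last first.
    by exists None => i Vi; exfalso; apply: noi; exists i.
  exists (Some i) => j Vj; congr Some; apply/eqP; apply: contrapT => /negP ij.
  have := Vdisj i j Logic.I Logic.I ij; rewrite -subset0 => /(_ x); exact.
exists (fun x => oapp (psi_^~ x) 0 (idx x)),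
  (fun j x => oapp (fun i => phis_ i j x) 0 (idx x)) => x [i _ Vi].
have [psic phic psib phi_le phif] := rep i x Vi.
have idx_near : \forall y \near x, idx y = Some i.
  by apply: filterS (open_nbhs_nbhs (conj (Vo i) Vi)) => y; exact: idxP.
split.
- by apply: near_eq_continuous psic; apply: filterS idx_near => y ->.
- by move=> j; apply: near_eq_continuous (phic j); apply: filterS idx_near => y ->.
- by rewrite (idxP _ _ Vi).
- by rewrite (idxP _ _ Vi).
- by rewrite (idxP _ _ Vi).
Qed.

Lemma local_rep_countable_cover (V : nat -> set K) :
    (forall n, open (V n)) -> (forall x, exists n, V n x) ->
    (forall n, representable (V n)) ->
  representable setT.
Proof.
move=> Vo Vcover /choice[psi_ /choice[phis_ rep]].
have [w [N [wc w0 wV wN w1]]] := countable_partition_of_unity V Vo Vcover.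
have wsum_le (a : nat -> R) x e : (forall n, V n x -> a n <= e) ->
    \sum_(n < N x) w n x * a n <= e.
  move=> ae; rewrite -[leRHS]mul1r -(w1 x) mulr_suml; apply: ler_sum => n _.
  have [Vx|/wV ->] := pselect (V n x); last by rewrite !mul0r.
  by rewrite ler_wpM2l ?ae.
have wcomb_c (g : nat -> K -> R[i]^o) e :
    (forall n x, V n x -> {for x, continuous (g n)}) ->
    (forall n x, V n x -> normc (g n x) <= e) ->
    continuous (fun x => \sum_(n < N x) (w n x)%:C * g n x : R[i]^o).
  move=> gc gb; apply: (@locally_finite_sum_continuous _ _ _
      (fun n x => (w n x)%:C * g n x : R[i]^o)) => [n|x].
    apply: (weighted_continuous (V n) _ _ e) => // y;
      [exact: wV|exact: gc|exact: gb].
  by apply: filterS (wN x) => z wz n /wz ->; exact: mul0r.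
have normc_w n x z : normc ((w n x)%:C * z) = w n x * normc z.
  by rewrite ComplexField.Normc.normcM normc_real ger0_norm.
have psic : continuous (fun x => \sum_(n < N x) (w n x)%:C * psi_ n x : R[i]^o).
  apply: (wcomb_c psi_ b) => n y /rep[hc _ hb _ _]; [exact: hc|exact: hb].
have phic j :
    continuous (fun x => \sum_(n < N x) (w n x)%:C * phis_ n j x : R[i]^o).
  apply: (wcomb_c (fun n => phis_ n j) c) => n y /rep[_ hc _ hb _].
    exact: hc.
  (* The term of index [j] is the last one in the partial sum of length [j.+1]. *)
  apply: le_trans (hb j.+1).
  rewrite seriesEnat /= big_nat_recr//= lerDr.
  by apply: sumr_ge0 => k _; exact: normc_ge0.
exists (fun x => \sum_(n < N x) (w n x)%:C * psi_ n x),
  (fun j x => \sum_(n < N x) (w n x)%:C * phis_ n j x) => x _; split.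
- exact: psic.
- by move=> j; exact: phic.
- rewrite (le_trans (normc_sum_le _ _ _ _))//.
  under eq_bigr do rewrite normc_w.
  by apply: (wsum_le (fun n => normc (psi_ n x))) => n /rep[_ _ hb _ _].
- move=> m; rewrite seriesEnat /=.
  apply: (@le_trans _ _ (\sum_(n < N x) w n x *
      series (fun j => normc (phis_ n j x)) m)).
    under [leRHS]eq_bigr do rewrite seriesEnat /= mulr_sumr.
    rewrite exchange_big /=; apply: ler_sum => j _.
    by rewrite (le_trans (normc_sum_le _ _ _ _))//; apply: ler_sum => n _; rewrite normc_w.
  apply: (wsum_le (fun n => series (fun j => normc (phis_ n j x)) m)) => n.
  by case/rep => _ _ _ hb _; exact: hb.
(* The weights sum to 1, so [f x] can be distributed over them; the limit is then taken inside a
   finite sum. *)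
- have -> : f x - \sum_(n < N x) (w n x)%:C * psi_ n x =
      \sum_(n < N x) (w n x)%:C * (f x - psi_ n x).
    under [RHS]eq_bigr do rewrite mulrBr.
    by rewrite sumrB -mulr_suml -rmorph_sum w1 mul1r.
  have -> : series (fun j => \sum_(n < N x) (w n x)%:C * phis_ n j x) =
      fun m => \sum_(n < N x) (w n x)%:C * series (phis_ n ^~ x) m.
    apply/funext => m; rewrite seriesEnat /= exchange_big /=.
    by apply: eq_bigr => n _; rewrite seriesEnat /= mulr_sumr.
  apply: cvg_big => [|n _]; first exact: add_continuous.
  have [Vx|/wV ->] := pselect (V n x); last first.
    by rewrite mul0r; under eq_fun do rewrite mul0r; exact: cvg_cst.
  apply: cvgM; first exact: cvg_cst.
  by have [_ _ _ _] := rep n x Vx; exact.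
Qed.

(** For fixed [n] the refining sets are disjoint and merge into one representable open set; the
    merged sets form a countable cover. *)
Lemma local_rep_open_cover :
    (forall x, exists U, [/\ open U, U x & representable U]) ->
  representable setT.
Proof.
move=> /choice[U UP].
have Uo x : open (U x) by have [] := UP x.
have [V [Vo VU Vdisj Vcover]] := sigma_disjoint_refinement U Uo (fun x =>
  let: And3 _ Ux _ := UP x in Ux).
apply: (@local_rep_countable_cover (fun n => \bigcup_x V n x)) => [n|z|n].
- by apply: bigcup_open => x _.
- by have [n [x Vz]] := Vcover z; exists n, x.
- apply: local_rep_bigcup => // x; have [_ _ [psi [phis rep]]] := UP x.
  by exists psi, phis => z /VU; exact: rep.
Qed.

End Gluing.

(** * From subspaces to the whole space *)

Section Main.
Context {R : realType} {K : metricType R}.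
Implicit Types (f : K -> R[i]^o) (b c : R).

Lemma continuous_valL_open (U : set K) (g : U -> R[i]^o) : open U ->
  continuous g -> forall x, U x -> {for x, continuous ('valL_(0 : R[i]^o) g)}.
Proof.
move=> Uo /(subspace_valL_continuousP' U (0 : R[i]^o)).
rewrite (continuous_open_subspace _ Uo) => gc x Ux.
by apply: gc; rewrite inE.
Qed.

(** Extension by zero carries a series on the subtype [U] to total functions. The bound on [psi] is
    requested only under [|f - psi| <= c], which the series itself supplies; this serves both
    [psi = 0] with [b = 0] and the general case. *)
Lemma Dnorm_local_rep f b c (U : set K) (psi : U -> R[i]^o) :
    0 <= c -> open U -> continuous psi ->
    (forall x : U, normc (f (set_val x) - psi x) <= c ->  normc (psi x) <= b) ->
    (Dnorm (fun x => (sigL U f x - psi x)%R) < c%:E)%E ->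
  exists psi phis, local_rep f b c U psi phis.
Proof.
move=> c0 Uo psic psib /Dnorm_lt -/(_ c0)[phis [phic phi_le phif]].
exists ('valL_(0 : R[i]^o) psi), (fun j => 'valL_(0 : R[i]^o) (phis j)) => x Ux.
have valLE (g : U -> R[i]^o) (u : U) : 'valL_(0 : R[i]^o) g (set_val u) = g u.
  by rewrite -[RHS](congr1 (fun h => h u) (valLK 0 g)).
have valL_c g gc := continuous_valL_open U g Uo gc x Ux.
have psi_c := valL_c psi psic; have phi_c j := valL_c (phis j) (phic j).
pose u : U := SigSub (mem_set Ux).
have xu : x = set_val u by []; rewrite {}xu in psi_c phi_c *; split.
- exact: psi_c.
- exact: phi_c.
- rewrite valLE; apply: psib.
  apply: (cvg_normc_le _ _ _ _ (phif u)) => n.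
  by rewrite (le_trans _ (phi_le u n))// !seriesEnat normc_sum_le.
- by move=> n; under eq_fun do rewrite valLE; exact: phi_le.
- by rewrite valLE; under eq_fun do rewrite valLE; exact: phif.
Qed.

End Main.

Theorem proposition1p14 (R : realType) (K : metricType R) (lambda : R)
    (f : K -> R[i]^o) (lambda_gt0 : 0 < lambda) (f_bounded : bounded_fun f) :
  ((forall x : K, exists U : set K,
      [/\ open U, U x & (Dnorm (sigL U f) <= lambda%:E)%E]) ->
   Dspace f /\ (Dnorm f <= lambda%:E)%E) /\
  ((forall x : K, exists U : set K,
      [/\ open U, U x & (qDnorm (sigL U f) <= lambda%:E)%E]) ->
   (qDnorm f <= lambda%:E)%E).
Proof.
split=> [Dloc|qDloc].
(* The slack [e] makes the local inequalities strict, so that each neighborhood has a series with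
   the same bound [lambda + e]. *)
- have rep e : 0 < e -> exists phis : nat -> K -> R[i]^o,
    [/\ forall j, continuous (phis j),
      forall x n, series (fun j => normc (phis j x)) n <= lambda + e &
      forall x, series (phis^~ x) @ \oo --> f x].
    move=> e0; have le0 : 0 <= lambda + e by rewrite addr_ge0 ?ltW.
    (* The bound [b = 0] forces the glued [psi] to vanish identically. *)
    have [|psi [phis rep]] := @local_rep_open_cover R K f 0 (lambda + e).
      move=> x; have [U [Uo Ux DU]] := Dloc x; exists U; split => //.
      apply: (@Dnorm_local_rep _ _ _ _ _ _ (fun=> 0)) => //.
      - exact: cst_continuous.
      - by move=> y _; rewrite ComplexField.Normc.normc0.
      - under eq_fun do rewrite subr0.
        by rewrite (le_lt_trans DU)// lte_fin ltrDl.
    exists phis; split=> [j x|x|x];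
      have [_ phic psi0 phi_le phif] := rep x Logic.I.
    - exact: phic.
    - exact: phi_le.
    have psix : psi x = 0.
      by apply: ComplexField.Normc.eq0_normc; apply/le_anti; rewrite psi0 normc_ge0.
    by move: phif; rewrite psix subr0.
  split.
    have [phis [phic phi_le phif]] := rep 1 ltr01.
    exact: bounded_series_Dspace phic phi_le phif.
  apply/lee_addgt0Pr => e e0; have [phis [phic phi_le phif]] := rep e e0.
  rewrite -EFinD; apply: bounded_series_Dnorm phic phi_le phif.
  by rewrite addr_ge0 ?ltW.
- apply/lee_addgt0Pr => e e0; have le0 : 0 <= lambda + e by rewrite addr_ge0 ?ltW.
  have [M fM] := (bounded_fun_normcP f).1 f_bounded.
  have [|psi [phis rep]] := @local_rep_open_cover R K f (M + (lambda + e)) (lambda + e).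
    move=> x; have [U [Uo Ux qDU]] := qDloc x; exists U; split => //.
    have : (qDnorm (sigL U f) < (lambda + e)%:E)%E.
      by rewrite (le_lt_trans qDU)// lte_fin ltrDl.
    move=> /ereal_inf_lt[_ [psi [psic _] <-] Dlt].
    apply: Dnorm_local_rep Dlt => // y fpsi.
    rewrite -[psi y](subKr (f (set_val y))) (le_trans (normcD_le _ _))//.
    by rewrite normcN lerD.
  (* The glued [psi] is continuous and bounded, hence a competitor in the infimum defining
     [qDnorm f]. *)
  apply: (@le_trans _ _ (Dnorm (fun x => f x - psi x))).
    apply: ereal_inf_lbound; exists psi => //; split.
      by move=> x; have [hc _ _ _ _] := rep x Logic.I; exact: hc.
    apply/bounded_fun_normcP; exists (M + (lambda + e)) => x.
    by have [_ _ hb _ _] := rep x Logic.I; exact: hb.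
  rewrite -EFinD; apply: (bounded_series_Dnorm _ phis) => //.
  + by move=> j x; have [_ hc _ _ _] := rep x Logic.I; exact: hc.
  + by move=> x; have [_ _ _ hb _] := rep x Logic.I; exact: hb.
  + by move=> x; have [_ _ _ _ hf] := rep x Logic.I; exact: hf.
Qed.
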